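(* Let $n\geq 3$ be an integer. Then for every $n$-vertex unicyclic graph $G$, $$n(US_n)\geq n(G)\geq n(UP_n).$$
   Context: A unicyclic graph is a connected graph containing exactly one cycle. A subtree of a graph $G$ is a subgraph of $G$ (a vertex set together with an edge set) that is a tree; two subtrees are different if they differ as subgraphs. $n(G)$ denotes the number of subtrees of $G$, where by convention the empty subtree is also counted (so there is exactly one subtree with $0$ vertices). $S_n$ is the $n$-vertex star and $P_n$ the $n$-vertex path. $US_n$ is the unicyclic graph obtained from $S_n$ by adding an edge joining two of its leaves. $UP_n$ is the unicyclic graph obtained by identifying a vertex of the triangle $C_3$ with an end vertex of $P_{n-2}$. *)

(* Defs.v *)
(* Simple graphs on vertex set 'I_n, given by their edge set:
   a set of 2-element subsets of 'I_n. *)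
From mathcomp Require Import all_boot.
From mathcomp Require Import boolp.
Set Implicit Arguments. Unset Strict Implicit. Unset Printing Implicit Defensive.

Section Graphs.
Variable n : nat.
Notation V := 'I_n.
Notation graph := {set {set V}}.

Definition simple_graph (E : graph) : Prop := forall e, e \in E -> #|e| = 2.

Definition adj (E : graph) : rel V := fun x y => (x != y) && ([set x; y] \in E).

Definition connected_on (W : {set V}) (E : graph) : Prop :=
  forall x y, x \in W -> y \in W -> connect (adj E) x y.

Definition cycle_edges (s : seq V) : graph := [set [set x; next s x] | x in s].

Definition is_cycle_seq (E : graph) (s : seq V) : Prop :=
  [/\ uniq s, 3 <= size s & cycle (adj E) s].

Definition is_cycle_of (E : graph) (C : graph) : Prop :=
  exists s, is_cycle_seq E s /\ C = cycle_edges s.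

Definition acyclic (E : graph) : Prop := forall s, ~ is_cycle_seq E s.

Definition unicyclic (E : graph) : Prop :=
  connected_on setT E /\ exists! C, is_cycle_of E C.

Definition subgraph_of (E : graph) (W : {set V}) (F : graph) : Prop :=
  F \subset E /\ (forall e, e \in F -> e \subset W).

Definition is_tree (W : {set V}) (F : graph) : Prop :=
  W != set0 /\ connected_on W F /\ acyclic F.

Definition is_subtree (E : graph) (p : {set V} * graph) : Prop :=
  subgraph_of E p.1 p.2 /\ (is_tree p.1 p.2 \/ p = (set0, set0)).

Definition subtrees (E : graph) : {set {set V} * graph} :=
  [set p | `[< is_subtree E p >]].

Definition nsub (E : graph) : nat := #|subtrees E|.

Definition mk_graph (r : nat -> nat -> bool) : graph :=
  [set e : {set V} | [exists x : V, exists y : V,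
     [&& x < y, r x y & e == [set x; y]]]].

(* US_n: star with center 0 and leaves 1..n-1, plus the edge {1,2} *)
Definition US : graph :=
  mk_graph (fun x y => ((x == 0) && (1 <= y)) || ((x == 1) && (y == 2))).

(* UP_n: triangle on 0,1,2, with the path 2 - 3 - ... - (n-1) attached at 2 *)
Definition UP : graph :=
  mk_graph (fun x y => ((x == 0) && (y == 1)) || ((x == 0) && (y == 2))
                       || ((1 <= x) && (y == x.+1))).
End Graphs.

(* Main.v *)
(** The empty subtree aside, a subtree is a pair (vertex set, edge set), and a
    subtree with at least one edge is determined by its edges.

    Upper bound.  A unicyclic graph has at most n edges, so it suffices that at
    least a quarter of all edge sets are not the edge set of a tree.  Let e, f, h
    be three consecutive edges of the cycle and let Z avoid them.  Adding to a
    tree an edge between two of its vertices, or to a nonempty edge set an edge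
    disjoint from it, never gives a tree.  Hence one of Z, Z+e, Z+f, Z+h, Z+e+f,
    Z+f+h fails to be a tree, and so does one of Z+e+h, Z+e+f+h.  The bound
    3 * 2^(n-2) on the number of tree edge sets is attained by US_n.

    Lower bound.  Put the vertices in an order whose initial segments are
    connected and which lists the cycle first.  A vertex added to a connected set
    lies in trees of every size 1, ..., j of the resulting j-vertex set; if the
    cycle is already present, the two ways around it give three further trees.
    The last cycle vertex lies in min(i, 4) trees of each size i.  This yields
    n(n+1)/2 + 3(n-2) nonempty subtrees, and UP_n has no more than that, as
    one sees by removing the end of its tail repeatedly. *)
Require Import Defs.
From mathcomp Require Import all_boot.
From mathcomp Require Import boolp.
From mathcomp Require Import zify.
Set Implicit Arguments. Unset Strict Implicit. Unset Printing Implicit Defensive.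

(** * Cycles and pendant edges *)

Section Basics.
Variable n : nat.
Notation V := 'I_n.
Notation graph := {set {set V}}.
Implicit Types (E F H Z : graph) (U W : {set V}).

Lemma adjC E : symmetric (adj E).
Proof. by move=> x y; rewrite /adj eq_sym setUC. Qed.

Lemma adj_connectC E : connect_sym (adj E).
Proof. exact/sym_connect_sym/adjC. Qed.

Lemma adjS E F : E \subset F -> subrel (adj E) (adj F).
Proof. by move=> sEF x y /andP[nxy /(subsetP sEF) xyF]; rewrite /adj nxy. Qed.

Lemma connect_adjS E F x y :
  E \subset F -> connect (adj E) x y -> connect (adj F) x y.
Proof.
by move=> sEF; apply: connect_sub => a b /(adjS sEF) ab; apply: connect1.
Qed.

Lemma edge_neq E x y : simple_graph E -> [set x; y] \in E -> x != y.
Proof. by move=> sE /sE; rewrite cards2; case: eqP. Qed.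

Lemma connect_exit (e : rel V) W x y : connect e x y -> x \in W -> y \notin W ->
  exists a b, [/\ a \in W, b \notin W & e a b].
Proof.
move=> /connectP[p]; elim: p x => [|z p IHp] x /=.
  by move=> _ -> xW; rewrite xW.
case/andP=> exz pz yl xW yW.
case: (boolP (z \in W)) => zW; first exact: IHp pz yl zW yW.
by exists x, z.
Qed.

(** Rotation puts a chosen vertex first, so facts about [next] reduce to computing on an explicit
    head of the list. *)
Lemma rot_next (s : seq V) x : uniq s -> x \in s ->
  exists t, [/\ uniq (x :: t), size (x :: t) = size s,
     (forall e : rel V, cycle e (x :: t) = cycle e s),
     x :: t =i s & next s =1 next (x :: t)].
Proof.
move=> us /rot_to[i t Ert]; exists t; rewrite -Ert; split.
- by rewrite rot_uniq.
- exact: size_rot.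
- by move=> e; rewrite rot_cycle.
- exact: mem_rot.
- by move=> y; rewrite next_rot.
Qed.

Lemma next_neq (s : seq V) x : uniq s -> 2 <= size s -> x \in s -> next s x != x.
Proof.
move=> us s2 /(rot_next us)[[|y t] [ut Es _ _ nE]]; move: s2 ut; rewrite -Es nE //= => _.
by rewrite eqxx inE negb_or eq_sym; case: eqP.
Qed.

Lemma next2_neq (s : seq V) x : uniq s -> 3 <= size s -> x \in s ->
  next s (next s x) != x.
Proof.
move=> us s2 /(rot_next us)[[|y [|z t]] [ut Es _ _ nE]]; move: s2 ut; rewrite -Es nE //= => _.
rewrite !nE /= !inE !negb_or => /andP[/and3P[xy xz _] _].
by rewrite eqxx (eq_sym y x) (negPf xy) eqxx eq_sym.
Qed.

Lemma next3_neq (s : seq V) x : uniq s -> 4 <= size s -> x \in s ->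
  next s (next s (next s x)) != x.
Proof.
move=> us s2 /(rot_next us)[[|y [|z [|w t]]] [ut Es _ _ nE]];
  move: s2 ut; rewrite -Es nE //= => _.
rewrite !nE /= !inE !negb_or => /andP[/and4P[xy xz xw _]].
case/andP=> /and3P[yz _ _] _.
rewrite eqxx (eq_sym y x) (negPf xy) eqxx (eq_sym z x) (negPf xz).
by rewrite (eq_sym z y) (negPf yz) eqxx eq_sym.
Qed.

Lemma acyclicS E F : E \subset F -> acyclic F -> acyclic E.
Proof.
move=> sEF aF s [us s3 cs]; apply: (aF s); split=> //.
exact: sub_cycle (adjS sEF) _ cs.
Qed.

Lemma is_tree1 (v : V) : is_tree [set v] (set0 : graph).
Proof.
split; first by apply/set0Pn; exists v; rewrite inE.
split; first by move=> x y /set1P-> /set1P->.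
case=> [|x s] [us s3 cs] //.
have := next_cycle cs (mem_head x s).
by rewrite /adj inE andbF.
Qed.

(** The only neighbour of [y] is [x], so on a cycle through [y] the vertex [x] would both precede
    and follow it; a cycle avoiding [y] already lies in [F]. *)
Lemma is_tree_add W F x y : (forall e, e \in F -> e \subset W) ->
  is_tree W F -> x \in W -> y \notin W ->
  is_tree (y |: W) ([set x; y] |: F).
Proof.
move=> sFW [W0 [cW aF]] xW yW.
have sF : F \subset [set x; y] |: F by apply: subsetUr.
have nxy : x != y by apply: contraNneq yW => <-.
have axy : adj ([set x; y] |: F) x y by rewrite /adj nxy setU11.
split; first by apply/set0Pn; exists y; rewrite setU11.
split.
  have cx z : z \in y |: W -> connect (adj ([set x; y] |: F)) x z.
    case/setU1P=> [->|zW]; first exact: connect1.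
    exact/(connect_adjS sF)/cW.
  move=> a b aW bW; apply: connect_trans (cx _ bW).
  by rewrite adj_connectC; apply: cx.
move=> s [us s3 cs].
have ay z : adj ([set x; y] |: F) y z -> z = x.
  rewrite /adj => /andP[nyz /setU1P[|/sFW]].
    move=> /setP/(_ z); rewrite !inE eqxx orbT.
    by rewrite (eq_sym z y) (negPf nyz) orbF => /esym/eqP.
  by move/subsetP/(_ y); rewrite !inE eqxx => /(_ isT); rewrite (negPf yW).
have [ys|ys] := boolP (y \in s).
  have h1 := ay _ (next_cycle cs ys).
  have h2 : prev s y = x by apply: ay; rewrite adjC; apply: prev_cycle.
  have := next2_neq us s3 ys; rewrite h1 -h2 next_prev // eqxx.
  by [].
apply: (aF s); split=> //.
have sub : {in s &, subrel (adj ([set x; y] |: F)) (adj F)}.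
  move=> a b a_s b_s /andP[nab /setU1P[|abF]]; last by rewrite /adj nab.
  move=> /setP/(_ y); rewrite !inE eqxx orbT.
  by case/orP=> /eqP yE; move: ys; rewrite yE ?a_s ?b_s.
exact: (sub_in_cycle sub (allss s) cs).
Qed.

(** A duplicate-free path from [x] to [y] closes up. It has at least three vertices because the edge
    itself is not in [F]. *)
Lemma close_cycle F x y : connect (adj F) x y -> x != y -> [set x; y] \notin F ->
  exists s, [/\ is_cycle_seq ([set x; y] |: F) s,
     [set x; y] \in cycle_edges s & cycle_edges s \subset [set x; y] |: F].
Proof.
move=> /connectP[p0 pp0 Ey] nxy xyF; case: (shortenP pp0) Ey => p pp up _ Ey {p0 pp0}.
have sF : F \subset [set x; y] |: F by apply: subsetUr.
have cp : cycle (adj ([set x; y] |: F)) (x :: p).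
  rewrite /= rcons_path (sub_path (adjS sF) pp) /= -Ey.
  by rewrite /adj eq_sym nxy setUC setU11.
have s3 : 2 < size (x :: p).
  case: p pp up Ey {cp} => [|a [|b p]] //=; first by move=> _ _ yE; rewrite yE eqxx in nxy.
  by rewrite andbT => /andP[_ xaF] _ yE; rewrite yE xaF in xyF.
exists (x :: p); split=> //.
  apply/imsetP; exists y; first by rewrite Ey; apply: mem_last.
  (* As [y] is the last vertex, its successor is the default value of [nth], which is the head
     [x]. *)
  have -> : next (x :: p) y = x.
    by rewrite next_nth Ey mem_last index_last // nth_default.
  by rewrite setUC.
apply/subsetP=> e /imsetP[z zs ->].
by have /andP[_] := next_cycle cp zs.
Qed.

End Basics.

(** * Growing trees *)

Section Trees.
Variable n : nat.
Notation V := 'I_n.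
Notation graph := {set {set V}}.
Implicit Types (E F H Z : graph) (U W : {set V}) (p : {set V} * graph).

(** The nonempty subtrees, confined to [U] so that they can be counted while [U] grows one vertex at
    a time. *)
Definition tree_in E U p : Prop :=
  [/\ subgraph_of E p.1 p.2, is_tree p.1 p.2 & p.1 \subset U].

Definition trees E U : {set {set V} * graph} := [set p | `[< tree_in E U p >]].

Definition trees_through E U (v : V) := [set p in trees E U | v \in p.1].

Definition induced E U : graph := [set e in E | e \subset U].

Lemma treesP E U p : reflect (tree_in E U p) (p \in trees E U).
Proof. by rewrite inE; apply: asboolP. Qed.

Lemma inducedS E U : induced E U \subset E.
Proof. by apply/subsetP => e; rewrite inE => /andP[]. Qed.

Lemma induced_sub E U e : e \in induced E U -> e \subset U.
Proof. by rewrite inE => /andP[]. Qed.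

Lemma tree_in_S E H U W p : H \subset E -> W \subset U ->
  tree_in H W p -> tree_in E U p.
Proof.
move=> sHE sWU [[sF eW] tp pW]; split=> //; last exact: subset_trans sWU.
by split=> //; apply: subset_trans sHE.
Qed.

Lemma tree_in_induced E U p : tree_in E U p <-> tree_in (induced E U) U p.
Proof.
split; last exact/tree_in_S/subxx/inducedS.
case=> [[sF eW] tp pW]; split=> //; split=> //.
apply/subsetP=> e eF; rewrite inE (subsetP sF) //=.
exact: subset_trans (eW e eF) pW.
Qed.

Lemma tree_in1 E U v : v \in U -> tree_in E U ([set v], set0).
Proof.
move=> vU; split=> /=; last by rewrite sub1set.
  by split; [exact: sub0set | move=> e; rewrite inE].
exact: is_tree1.
Qed.

Lemma tree_in_add E U W F x y : tree_in E U (W, F) ->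
  x \in W -> y \notin W -> y \in U -> [set x; y] \in E ->
  tree_in E U (y |: W, [set x; y] |: F).
Proof.
move=> [[/= sF eW] tp pW] xW yW yU xyE; split=> /=.
- split; first by rewrite subUset sub1set xyE.
  move=> e /setU1P[->|/eW eW']; last exact: subset_trans eW' (subsetUr _ _).
  by rewrite subUset !sub1set setU11 setU1r.
- exact: is_tree_add.
- by rewrite subUset sub1set yU.
Qed.

Lemma card_add_edge E U W F x y : tree_in E U (W, F) -> y \notin W ->
  #|[set x; y] |: F| = #|F|.+1.
Proof.
move=> [[/= sF eW] tp pW] yW; rewrite cardsU1 (_ : _ \notin F) //.
apply: contra yW => /eW/subsetP; apply; by rewrite !inE eqxx orbT.
Qed.

Lemma grow_step H U W F : (forall e, e \in H -> e \subset U) ->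
  connected_on U H -> tree_in H U (W, F) -> W != U ->
  exists x y, [/\ x \in W, y \notin W, y \in U, [set x; y] \in H &
    tree_in H U (y |: W, [set x; y] |: F)].
Proof.
move=> eU cU tW nWU; have [_ [W0 _] /= sWU] := tW.
have /set0Pn[w wW] := W0.
have /properP[_ [z zU zW]] : W \proper U by rewrite properEneq nWU.
have [x [y [xW yW /andP[_ xyH]]]] := connect_exit (cU _ _ (subsetP sWU _ wW) zU) wW zW.
have yU : y \in U by apply: (subsetP (eU _ xyH)); rewrite !inE eqxx orbT.
by exists x, y; split=> //; apply: tree_in_add.
Qed.

(** Repeating [grow_step] adds one edge per vertex. The last equation records this; for a full
    vertex set it gives the number of edges of a spanning tree. *)
Lemma grow H U W F s : (forall e, e \in H -> e \subset U) ->
  connected_on U H -> tree_in H U (W, F) -> #|W| <= s <= #|U| ->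
  exists W' F', [/\ tree_in H U (W', F'), W \subset W', F \subset F', #|W'| = s
    & #|F'| + #|W| = #|F| + s].
Proof.
move=> eU cU tW; elim: s => [|s IHs].
  rewrite leqn0 => /andP[/eqP W0 _]; exists W, F; split=> //.
  by rewrite W0.
case: (eqVneq #|W| s.+1) => [Ws _|nWs /andP[Ws sU]].
  by exists W, F; split=> //; rewrite Ws.
have [|W' [F' [tW' sW sF cW' cF']]] := IHs; first by lia.
have nW'U : W' != U by apply: contraTneq sU => <-; rewrite cW' ltnn.
have [x [y [xW yW yU xyH tN]]] := grow_step eU cU tW' nW'U.
exists (y |: W'), ([set x; y] |: F'); split=> //.
- exact: subset_trans sW (subsetUr _ _).
- exact: subset_trans sF (subsetUr _ _).
- by rewrite cardsU1 yW cW'.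
- by rewrite (card_add_edge _ tW') // addSn cF' addnS.
Qed.

Lemma nsub_trees E : nsub E = (#|trees E setT|).+1.
Proof.
rewrite /nsub (_ : subtrees E = (set0, set0) |: trees E setT).
  rewrite cardsU1; case: treesP => // -[_ [/=]]; by rewrite eqxx.
apply/setP=> p; rewrite [LHS]inE in_setU1.
apply/asboolP/orP => [[sp [tp|->]]|[/eqP->|/treesP[sp tp _]]].
- by right; apply/treesP; split.
- by left.
- by split; [split=> /= [|e]; rewrite ?sub0set ?inE | right].
- by split=> //; left.
Qed.

(** The recursion behind all vertex-by-vertex counts: the trees avoiding [v] are those already
    inside [U]. *)
Lemma card_treesU1 E U v : v \notin U ->
  #|trees E (v |: U)| = #|trees E U| + #|trees_through E (v |: U) v|.
Proof.
move=> vU; rewrite -(cardsID [set p : {set V} * graph | v \in p.1] (trees E (v |: U))) addnC.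
congr (_ + _); apply: eq_card => p; rewrite !inE // andbC.
apply/idP/idP.
  case/andP=> /asboolP[sp tp pU] vp; apply/asboolP; split=> //.
  apply/subsetP=> x xp; have /setU1P[xv|//] := subsetP pU x xp.
  by rewrite -xv xp in vp.
move=> /asboolP[sp tp pU]; apply/andP; split.
  by apply/asboolP; split=> //; apply: subset_trans pU (subsetUr _ _).
by apply: contra vU; apply: (subsetP pU).
Qed.

(** Trees with different numbers of vertices are different, so bounds for each size add up. Index
    [s] stands for size [s.+1], sizes starting at 1. *)
Lemma sum_size_leq (A : {set {set V} * graph}) m (f : nat -> nat) :
  (forall s, s < m -> f s <= #|[set p in A | #|p.1| == s.+1]|) ->
  \sum_(s < m) f s <= #|A|.
Proof.
elim: m A => [|m IHm] A fA; first by rewrite big_ord0.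
rewrite big_ord_recr /= -(cardsID [set p : {set V} * graph | #|p.1| == m.+1] A) addnC leq_add //.
  apply: leq_trans (fA m (leqnn _)) _; apply: subset_leq_card.
  by apply/subsetP=> p; rewrite !inE.
apply: IHm => s sm; apply: leq_trans (fA s (leqW sm)) _; apply: subset_leq_card.
apply/subsetP=> p; rewrite !inE => /andP[-> /eqP->].
by rewrite eqSS (ltn_eqF sm) eqxx.
Qed.

Lemma induced_conn_add E U x y : connected_on U (induced E U) -> x \in U ->
  y \notin U -> [set x; y] \in E ->
  connected_on (y |: U) (induced E (y |: U)).
Proof.
move=> cU xU yU xyE.
have sI : induced E U \subset induced E (y |: U).
  apply/subsetP=> e; rewrite !inE => /andP[-> eU] /=.
  exact: subset_trans eU (subsetUr _ _).
have axy : adj (induced E (y |: U)) x y.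
  rewrite /adj inE xyE subUset !sub1set setU11 setU1r // !andbT.
  by apply: contraNneq yU => <-.
have cx z : z \in y |: U -> connect (adj (induced E (y |: U))) x z.
  case/setU1P=> [->|zU]; first exact: connect1.
  exact/(connect_adjS sI)/cU.
move=> a b aU bU; apply: connect_trans (cx _ bU).
by rewrite adj_connectC; apply: cx.
Qed.

Lemma some_tree_of_size E U v s : connected_on U (induced E U) -> v \in U ->
  0 < s <= #|U| -> 0 < #|[set p in trees_through E U v | #|p.1| == s]|.
Proof.
move=> cU vU sU.
have := @grow (induced E U) U [set v] set0 s (@induced_sub _ _) cU (tree_in1 _ vU).
rewrite cards1 => /(_ sU)[W [F [tW sW _ cW _]]].
have vW : v \in W by rewrite -sub1set.
apply/card_gt0P; exists (W, F); rewrite inE cW eqxx andbT inE vW andbT.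
exact/treesP/tree_in_induced.
Qed.

Lemma card_trees_through E U v : connected_on U (induced E U) -> v \in U ->
  #|U| <= #|trees_through E U v|.
Proof.
move=> cU vU; have := @sum_size_leq (trees_through E U v) #|U| (fun=> 1).
rewrite sum_nat_const card_ord muln1; apply=> s sU.
exact: some_tree_of_size.
Qed.

(** If [U] is built up through connected sets, the i-th vertex lies in at least i trees, one of each
    size; 1 + 2 + ... is a triangular number. *)
Lemma card_trees_conn E U : connected_on U (induced E U) ->
  #|U| * #|U|.+1 <= 2 * #|trees E U|.
Proof.
move=> cU; suff: forall m, m <= #|U| -> exists W, [/\ W \subset U, #|W| = m,
    connected_on W (induced E W) & m * m.+1 <= 2 * #|trees E W|].
  move=> /(_ _ (leqnn _))[W [sWU cW _]].
  by have /eqP -> : W == U by rewrite eqEcard sWU cW leqnn.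
elim=> [_|m IHm mU].
  exists set0; split; rewrite ?sub0set ?cards0 //.
  by move=> x y; rewrite inE.
have [W [sWU cW conW tW]] := IHm (ltnW mU).
have nWU : W != U by apply: contraTneq mU => <-; rewrite cW ltnn.
have [m0|] := posnP m.
  have [u uU] : exists u, u \in U by apply/card_gt0P; apply: leq_trans mU.
  have c1 : connected_on [set u] (induced E [set u]) by move=> x y /set1P-> /set1P->.
  exists [set u]; split; rewrite ?sub1set ?cards1 ?m0 //.
  suff : 0 < #|trees E [set u]| by lia.
  by apply/card_gt0P; exists ([set u], set0); apply/treesP/tree_in1; rewrite inE.
rewrite -cW => /card_gt0P[w wW].
have /properP[_ [z zU zW]] : W \proper U by rewrite properEneq nWU.
have [x [y [xW yW /andP[_ xyH]]]] :=
  connect_exit (cU _ _ (subsetP sWU _ wW) zU) wW zW.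
have yU : y \in U by apply: (subsetP (induced_sub xyH)); rewrite !inE eqxx orbT.
have xyE := subsetP (inducedS _ _) _ xyH.
have cW' := induced_conn_add conW xW yW xyE.
have c1 : #|y |: W| = m.+1 by rewrite cardsU1 yW cW.
exists (y |: W); split=> //; rewrite ?cW ?c1 //.
  by rewrite subUset sub1set yU.
rewrite card_treesU1 //.
have := card_trees_through cW' (setU11 _ _); rewrite c1; nia.
Qed.

(** The rest of the cycle still joins the ends of the removed edge, and every use of that edge can
    be replaced by this detour. *)
Lemma conn_cut_cycle_edge H U (s : seq V) x : connected_on U H ->
  is_cycle_seq H s -> x \in s -> connected_on U (H :\ [set x; next s x]).
Proof.
move=> cU [us s3 cs] xs a b aU bU.
have [t [ut Es cE _ nE]] := rot_next us xs.
move: s3 cs; rewrite -Es -cE nE {cE Es nE us xs s}.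
case: t ut => [|y [|z t]] //= ut _; rewrite eqxx => /andP[axy /andP[ayz]].
set d := [set x; y]; have nx : x \notin y :: z :: t by case/andP: ut.
rewrite rcons_path => /andP[pt lx].
have adjd u v : u != x -> v != x -> adj H u v -> adj (H :\ d) u v.
  move=> ux vx /andP[nuv uvH]; rewrite /adj nuv !inE uvH andbT.
  by apply/negP=> /eqP/setP/(_ x); rewrite !inE eqxx !(eq_sym x) (negPf ux) (negPf vx).
have ty u : u \in y :: z :: t -> u != x by apply: contraTneq => ->.
have cyl : connect (adj (H :\ d)) y (last z t).
  apply/connectP; exists (z :: t) => //=.
  have sub: {in mem (y :: z :: t) &, subrel (adj H) (adj (H :\ d))}.
    by move=> u v /ty ux /ty vx; apply: adjd.
  have := sub_in_path sub (allss (y :: z :: t)).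
  by rewrite /= => -> //; rewrite ayz.
have lyx : adj (H :\ d) (last z t) x.
  have /andP[nl lH] := lx; rewrite /adj nl !inE lH andbT.
  apply/negP=> /eqP/setP/(_ y); rewrite !inE eqxx orbT.
  have /negPf -> : y != x by apply: ty; rewrite mem_head.
  rewrite orbF => /eqP yl; case/and3P: ut => _.
  by rewrite yl mem_last.
have cxy : connect (adj (H :\ d)) x y.
  rewrite adj_connectC; exact: connect_trans cyl (connect1 lyx).
apply: connect_sub (cU a b aU bU) => u v /andP[nuv uvH].
have [uvd|uvd] := eqVneq [set u; v] d; last first.
  by apply: connect1; rewrite /adj nuv !inE uvH uvd.
have ud : u \in d by rewrite -uvd !inE eqxx.
have vd : v \in d by rewrite -uvd !inE eqxx orbT.
move: ud vd nuv; rewrite !inE => /orP[] /eqP-> /orP[] /eqP->; rewrite ?eqxx //.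
by rewrite adj_connectC.
Qed.

End Trees.

(** * Trees branching at a cycle *)

Section CycleBranching.
Variable n : nat.
Notation V := 'I_n.
Notation graph := {set {set V}}.
Implicit Types (E F H Z : graph) (U W : {set V}) (p : {set V} * graph).

Lemma cycle_edges_sub E (s : seq V) : is_cycle_seq E s -> cycle_edges s \subset E.
Proof.
case=> _ _ cs; apply/subsetP=> _ /imsetP[x xs ->].
by have /andP[] := next_cycle cs xs.
Qed.

Lemma induced_cycle E U (s : seq V) : is_cycle_seq E s -> {subset s <= U} ->
  is_cycle_seq (induced E U) s.
Proof.
case=> us s3 cs sU; split=> //.
have sub : {in s &, subrel (adj E) (adj (induced E U))}.
  move=> x y /sU xU /sU yU /andP[nxy xyE].
  by rewrite /adj nxy inE xyE subUset !sub1set xU.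
exact: (sub_in_cycle sub (allss s) cs).
Qed.

(** Here [a] follows and [b] precedes [c], while [a'] and [b'] lie one step further. In a triangle
    [a'] is [b] and [b'] is [a], hence the length condition at the end. *)
Lemma cycle_neighbours E (s : seq V) c : is_cycle_seq E s -> c \in s ->
  exists a b a' b', [/\ [/\ a \in s, b \in s, a' \in s & b' \in s],
   [/\ [set c; a] \in cycle_edges s, [set c; b] \in cycle_edges s,
       [set a; a'] \in cycle_edges s & [set b; b'] \in cycle_edges s],
   [/\ a != c, b != c, a' != c & b' != c], [/\ a != b, a' != a & b' != b] &
   4 <= size s -> a' != b /\ b' != a].
Proof.
move=> [us s3 cs] cS; have s2 := ltnW s3.
pose a := next s c; pose b := prev s c.
have [aS bS] : a \in s /\ b \in s by rewrite mem_next mem_prev.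
have nb : next s b = c by apply: next_prev.
have nb' : next s (prev s b) = b by apply: next_prev.
have b'S : prev s b \in s by rewrite mem_prev.
have nab : a != b.
  by apply: contraNneq (next2_neq us s3 cS) => ab; rewrite -/a ab nb.
have edge x : x \in s -> [set x; next s x] \in cycle_edges s.
  by move=> xs; apply/imsetP; exists x.
exists a, b, (next s a), (prev s b); split; split=> //.
- by rewrite mem_next.
- exact: edge.
- by have := edge _ bS; rewrite nb setUC.
- exact: edge.
- by have := edge _ b'S; rewrite nb' setUC.
- exact: next_neq.
- by have := next_neq us s2 bS; rewrite nb eq_sym.
- exact: next2_neq.
- by apply: contraNneq nab => b'c; rewrite -nb' b'c.
- exact: next_neq.
- by have := next_neq us s2 b'S; rewrite nb' eq_sym.
- by apply: contraNneq (next3_neq us H cS) => ab; rewrite -/a ab nb.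
- apply: contraNneq (next3_neq us H cS) => ab.
  by rewrite -/a -{1}ab nb' nb.
Qed.

Lemma set2_neq (x y z w : V) : x != z -> x != w ->
  ([set x; y] == [set z; w]) = false.
Proof.
move=> xz xw; apply/eqP=> /setP/(_ x).
by rewrite !inE eqxx (negPf xz) (negPf xw).
Qed.

Section Branching.
Variables (E : graph) (s : seq V) (c v : V) (U W0 : {set V}) (F0 : graph).
Hypotheses (sE : is_cycle_seq E s) (cs : c \in s) (sU : {subset s <= U})
  (T0 : tree_in E U (W0, F0)) (W0s : forall x, x \in W0 -> x \in s -> x = c)
  (cW0 : c \in W0) (vW0 : v \in W0).

Let Sz m := [set p in trees_through E U v | #|p.1| == m].

Lemma mem_size_class W F m : tree_in E U (W, F) -> W0 \subset W -> #|W| = m ->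
  (W, F) \in Sz m.
Proof.
move=> tW sW cW; rewrite !inE /= cW eqxx (subsetP sW) // andbT.
by rewrite andbT; apply/asboolP.
Qed.

(** Distinct values of the fingerprint [f] certify that the listed trees are distinct. *)
Lemma size_class_sub (l : seq ({set V} * graph)) m
    (f : {set V} * graph -> bool * bool * bool) :
  (forall p, p \in l -> [/\ tree_in E U p, W0 \subset p.1 & #|p.1| = m]) ->
  uniq (map f l) -> size l <= #|Sz m|.
Proof.
move=> lP /map_uniq ul; apply/card_geqP; exists l; split=> // -[W F] /lP[tW sW cW].
exact: mem_size_class.
Qed.

(** Deleting the cycle edge [d] leaves [U] connected, so growth can continue in the graph without
    [d]. *)
Lemma grow_avoiding W F d m : connected_on U (induced E U) -> tree_in E U (W, F) ->
  d \in cycle_edges s -> d \notin F -> #|W| <= m <= #|U| ->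
  exists W' F', [/\ tree_in E U (W', F'), W \subset W', F \subset F', #|W'| = m &
    d \notin F'].
Proof.
move=> cU tW /imsetP[x xs dE] dF mU; set H := induced E U :\ d.
have cH : connected_on U H.
  by rewrite /H dE; apply: conn_cut_cycle_edge; first exact: cU; first exact: induced_cycle.
have eH e : e \in H -> e \subset U by case/setD1P=> _; apply: induced_sub.
have tH : tree_in H U (W, F).
  have /tree_in_induced[[sF eW] tW' sW] := tW; split=> //; split=> //.
  by rewrite subsetD1 dF andbT.
have [W' [F' [tW' sW sF cW _]]] := grow eH cH tH mU.
exists W', F'; split=> //.
  by apply: tree_in_S tW' => //; apply: subset_trans (subsetDl _ _) (inducedS _ _).
have [[/= sF' _] _ _] := tW'.
by apply: contraTN isT => /(subsetP sF'); rewrite !inE eqxx.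
Qed.

(** From [c] the tree can enter the cycle by [a] or by [b], which gives two trees with one more
    vertex. For two more vertices it can take both, or go two steps in either direction; in a
    triangle these three trees share their vertex set but not their edges. *)
Lemma branching :
  [/\ 1 < #|Sz #|W0|.+1|, 2 < #|Sz #|W0|.+2| &
      connected_on U (induced E U) -> 4 <= size s ->
      forall m, #|W0| + 3 <= m <= #|U| -> 3 < #|Sz m|].
Proof.
have [a [b [a' [b' [[aS bS a'S b'S] [caE cbE aa'E bb'E] [ac bc a'c b'c]
  [ab a'a b'b] s4]]]]] := cycle_neighbours sE cs.
have cE := subsetP (cycle_edges_sub sE).
have aW : a \notin W0 by apply: contra_neqN ac => /W0s; apply.
have bW : b \notin W0 by apply: contra_neqN bc => /W0s; apply.
have a'W : a' \notin W0 by apply: contra_neqN a'c => /W0s; apply.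
have b'W : b' \notin W0 by apply: contra_neqN b'c => /W0s; apply.
have eW e : e \in F0 -> e \subset W0 by have [[_ eW] _ _] := T0; apply: eW.
have F0n x y : y \notin W0 -> [set x; y] \in F0 = false.
  move=> yW; apply: contraNF yW => /eW/subsetP; apply; by rewrite !inE eqxx orbT.
have ca_cb : ([set c; a] == [set c; b]) = false.
  by rewrite setUC set2_neq.
have cb_ca : ([set c; b] == [set c; a]) = false by rewrite eq_sym.
have cb_aa' : ([set c; b] == [set a; a']) = false.
  by rewrite set2_neq // eq_sym.
have ca_bb' : ([set c; a] == [set b; b']) = false.
  by rewrite set2_neq // eq_sym.
have Ta := tree_in_add T0 cW0 aW (sU aS) (cE _ caE).
have Tb := tree_in_add T0 cW0 bW (sU bS) (cE _ cbE).
have sW x (W : {set V}) : W0 \subset W -> W0 \subset x |: W.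
  by move=> ?; apply: subset_trans (subsetUr _ _).
(* The third entry is masked by the first two, because growth may or may not add aa' to the trees
   that miss ca or cb. *)
pose f p := ([set c; a] \in p.2, [set c; b] \in p.2,
  [&& [set c; a] \in p.2, [set c; b] \in p.2 & [set a; a'] \in p.2]).
have bWa : b \notin a |: W0 by rewrite !inE negb_or eq_sym ab.
have a'Wa : a' \notin a |: W0 by rewrite !inE negb_or a'a.
have b'Wb : b' \notin b |: W0 by rewrite !inE negb_or b'b.
have Tab := tree_in_add Ta (setU1r _ cW0) bWa (sU bS) (cE _ cbE).
have Taa' := tree_in_add Ta (setU11 _ _) a'Wa (sU a'S) (cE _ aa'E).
have Tbb' := tree_in_add Tb (setU11 _ _) b'Wb (sU b'S) (cE _ bb'E).
split.
- apply: (@size_class_sub [:: (a |: W0, [set c; a] |: F0); (b |: W0, [set c; b] |: F0)] _ f).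
    by move=> p; rewrite !inE => /orP[]/eqP->; split=> //=; rewrite ?cardsU1 ?aW ?bW ?sW.
  by rewrite /= /f /= !inE !eqxx ca_cb !F0n.
- apply: (@size_class_sub [:: (b |: (a |: W0), [set c; b] |: ([set c; a] |: F0));
     (a' |: (a |: W0), [set a; a'] |: ([set c; a] |: F0));
     (b' |: (b |: W0), [set b; b'] |: ([set c; b] |: F0))] _ f).
    move=> p; rewrite !inE => /or3P[]/eqP->; split=> //=;
     rewrite ?cardsU1 ?bWa ?a'Wa ?b'Wb ?aW ?bW ?sW //.
  by rewrite /= /f /= !inE !eqxx ca_cb cb_ca cb_aa' ca_bb' !F0n // !orbT.
move=> cU s4' m mU.
(* Four trees of size m, told apart by which of ca, cb, aa' they contain: each
   is grown from an arc around c while avoiding one cycle edge. *)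
have kU k : k <= 3 -> k + #|W0| <= m <= #|U| by move: mU; clear; lia.
have [a'b b'a] := s4 s4'.
have aa'_ca : ([set a; a'] == [set c; a]) = false.
  by rewrite setUC set2_neq.
have aa'_cb : ([set a; a'] == [set c; b]) = false by rewrite set2_neq.
have bb'_ca : ([set b; b'] == [set c; a]) = false by rewrite set2_neq // eq_sym.
have bb'_cb : ([set b; b'] == [set c; b]) = false by rewrite setUC set2_neq.
have aa'_bb' : ([set a; a'] == [set b; b']) = false by rewrite set2_neq // eq_sym.
have bb'_aa' : ([set b; b'] == [set a; a']) = false by rewrite eq_sym.
have aWb : a \notin b |: W0 by rewrite !inE negb_or ab.
have aWbb' : a \notin b' |: (b |: W0).
  by rewrite !inE negb_or eq_sym b'a negb_or ab.
have bWaa' : b \notin a' |: (a |: W0).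
  by rewrite !inE negb_or eq_sym a'b negb_or eq_sym ab.
have Tbb'a := tree_in_add Tbb' (setU1r _ (setU1r _ cW0)) aWbb' (sU aS) (cE _ caE).
have Taa'b := tree_in_add Taa' (setU1r _ (setU1r _ cW0)) bWaa' (sU bS) (cE _ cbE).
have [||W1 [F1 [T1 sW1 sF1 cW1 d1]]] := grow_avoiding cU Tb caE (m := m).
- by rewrite !inE ca_cb F0n.
- by rewrite cardsU1 bW ?addnA kU.
have [||W2 [F2 [T2 sW2 sF2 cW2 d2]]] := grow_avoiding cU Ta cbE (m := m).
- by rewrite !inE cb_ca F0n.
- by rewrite cardsU1 aW ?addnA kU.
have [||W3 [F3 [T3 sW3 sF3 cW3 d3]]] := grow_avoiding cU Tbb'a aa'E (m := m).
- by rewrite !inE aa'_ca aa'_cb aa'_bb' F0n.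
- by rewrite !cardsU1 aWbb' b'Wb bW ?addnA kU.
have [||W4 [F4 [T4 sW4 sF4 cW4 d4]]] := grow_avoiding cU Taa'b bb'E (m := m).
- by rewrite !inE bb'_ca bb'_cb bb'_aa' F0n.
- by rewrite !cardsU1 bWaa' a'Wa aW ?addnA kU.
apply: (@size_class_sub [:: (W1, F1); (W2, F2); (W3, F3); (W4, F4)] _ f).
  move=> p; rewrite !inE => /or4P[]/eqP->; split=> //=.
  - by apply: subset_trans sW1; apply: sW.
  - by apply: subset_trans sW2; apply: sW.
  - by apply: subset_trans sW3; apply/sW/sW/sW.
  - by apply: subset_trans sW4; apply/sW/sW/sW.
have cb1 : [set c; b] \in F1 by apply: (subsetP sF1); rewrite !inE eqxx.
have ca2 : [set c; a] \in F2 by apply: (subsetP sF2); rewrite !inE eqxx.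
have ca3 : [set c; a] \in F3 by apply: (subsetP sF3); rewrite !inE eqxx.
have cb3 : [set c; b] \in F3 by apply: (subsetP sF3); rewrite !inE eqxx !orbT.
have ca4 : [set c; a] \in F4 by apply: (subsetP sF4); rewrite !inE eqxx !orbT.
have cb4 : [set c; b] \in F4 by apply: (subsetP sF4); rewrite !inE eqxx.
have aa'4 : [set a; a'] \in F4 by apply: (subsetP sF4); rewrite !inE eqxx !orbT.
by rewrite /= /f /= !inE cb1 ca2 ca3 cb3 ca4 cb4 aa'4 (negPf d1) (negPf d2) (negPf d3).
Qed.
End Branching.
End CycleBranching.

(** * The lower bound *)

Section LowerBound.
Variable n : nat.
Notation V := 'I_n.
Notation graph := {set {set V}}.
Implicit Types (E F H Z : graph) (U W : {set V}) (p : {set V} * graph).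

Lemma conn_path E (x : V) t : path (adj E) x t ->
  connected_on [set z in x :: t] (induced E [set z in x :: t]).
Proof.
move=> pt; set W := [set z in x :: t].
have sub : {in x :: t &, subrel (adj E) (adj (induced E W))}.
  move=> a b aW bW /andP[nab abE].
  by rewrite /adj nab inE abE subUset !sub1set /W !in_set aW.
have cx z : z \in W -> connect (adj (induced E W)) x z.
  rewrite in_set; apply: path_connect.
  by rewrite (sub_in_path sub (allss (x :: t))).
move=> a b aW bW; apply: connect_trans (cx _ bW).
by rewrite adj_connectC; apply: cx.
Qed.

Lemma sum_minn4 k : 3 <= k -> \sum_(i < k) minn i.+1 4 = 4 * k - 6.
Proof.
elim: k => // k IHk; rewrite leq_eqVlt => /orP[/eqP <-|k3].
  by rewrite !big_ord_recr big_ord0.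
by rewrite big_ord_recr /= IHk //; lia.
Qed.

(** Without [c], a cycle of length k is a path on k - 1 vertices, with at least k(k-1)/2 trees.
    Branching from the single vertex [c] gives min(i, 4) trees of each size i, in total 1 + 2 + 3 +
    4(k-3) = 4k - 6 more. *)
Lemma card_trees_cycle E (s : seq V) : is_cycle_seq E s ->
  connected_on [set x in s] (induced E [set x in s]) /\
  size s * (size s).+1 + 6 * (size s - 2) <= 2 * #|trees E [set x in s]|.
Proof.
case: s => [|c [|y t]]; try by case.
set s := [:: c, y & t] => sE; have [us s3 cs] := sE.
pose P := [set x in y :: t].
have Vc : [set x in s] = c |: P by apply/setP=> x; rewrite !inE.
have cP : c \notin P by rewrite inE; case/andP: us.
have /= /andP[acy] := cs; rewrite rcons_path => /andP[pt _].
have conP : connected_on P (induced E P) by apply: conn_path.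
have /andP[nyc ycE] : adj E y c by rewrite adjC.
have yP : y \in P by rewrite inE mem_head.
have conVc := induced_conn_add conP yP cP ycE; rewrite -Vc in conVc.
split=> //.
have cardP : #|P| = (size s).-1.
  by rewrite cardsE; apply/card_uniqP; case/andP: us.
have cardVc : #|[set x in s]| = size s by rewrite cardsE; apply/card_uniqP.
have := card_trees_conn conP; rewrite Vc card_treesU1 // cardP -Vc.
suff : 4 * size s - 6 <= #|trees_through E [set x in s] c|.
  move: s3; rewrite -[(size t).+2]/(size s).
  move: (size s) #|trees E P| #|trees_through _ _ _| => [|k] N T //=; clear; nia.
rewrite -sum_minn4 //; apply: (@sum_size_leq _ _ _ (fun i => minn i.+1 4)) => i ik.
have sU : {subset s <= [set x in s]} by move=> x xs; rewrite in_set.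
have cU : c \in [set x in s] by rewrite in_set mem_head.
have [||||||S2 S3 S4] := @branching _ E s c c [set x in s] [set c] set0 sE.
- exact: mem_head.
- exact: sU.
- exact: tree_in1.
- by move=> x /set1P.
- by rewrite inE.
- by rewrite inE.
rewrite cards1 in S2 S3 S4.
case: i ik => [|[|[|i]]] // ik.
- by apply: some_tree_of_size => //; rewrite cardVc.
- rewrite (minn_idPr _) //; apply: S4 => //; last by rewrite cardVc.
  by apply: leq_trans ik.
Qed.

(** The profile of a vertex off the cycle: one tree of each size, one extra of size [q.+1] and two
    extra of size [q.+2]. *)
Lemma sum_peaks m q :
  \sum_(i < m) (1 + (i == q :> nat) + 2 * (i == q.+1 :> nat)) =
  m + (q < m) + 2 * (q.+1 < m).
Proof.
by elim: m => [|m IHm]; rewrite ?big_ord0 // big_ord_recr /= IHm; lia.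
Qed.

(** Growth gives one tree through [y] of each of the #|W| + 1 sizes. Branching at the vertex where a
    tree from [y] first meets the cycle gives three more. *)
Lemma card_trees_off_cycle E (s : seq V) W x y : is_cycle_seq E s ->
  {subset s <= W} -> connected_on W (induced E W) -> x \in W -> y \notin W ->
  [set x; y] \in E -> #|W| + 4 <= #|trees_through E (y |: W) y|.
Proof.
move=> sE sW cW xW yW xyE; set U := y |: W.
have sU : {subset s <= U} by move=> z /sW zW; rewrite setU1r.
have cU : connected_on U (induced E U) := induced_conn_add cW xW yW xyE.
have yU : y \in U by rewrite setU11.
(* A maximal tree through [y] off the cycle can only be extended onto the
   cycle; the extension then meets the cycle in a single vertex. *)
pose P p := (p \in trees_through E U y) && [disjoint p.1 & [set z in s]].
have P0 : P ([set y], set0).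
  rewrite /P !inE eqxx andbT; apply/andP; split.
    exact/asboolP/tree_in1.
  rewrite disjoint_subset; apply/subsetP=> z /set1P->; rewrite !inE.
  by apply: contra yW => /sW.
case: (@arg_maxnP _ _ P (fun p => #|p.1|) P0) => -[W1 F1].
rewrite /P inE /= => /andP[/andP[/treesP t1 yW1] dW1] max1.
have sW1 : forall z, z \in W1 -> z \notin s.
  by move=> z zW1; have := disjointFr dW1 zW1; rewrite inE => ->.
have [_ s3 _] := sE.
have [c0 c0s] : exists c0, c0 \in s by case: (s) s3 => // c0 l _; exists c0; rewrite mem_head.
have nW1U : W1 != U by apply/eqP=> W1U; have := sW1 c0; rewrite W1U sU // c0s => /(_ isT).
have [w [c [wW1 cW1 cU' wcE tN]]] :=
  grow_step (@induced_sub _ E U) cU ((tree_in_induced _ _ _).1 t1) nW1U.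
have t0 := (tree_in_induced _ _ _).2 tN.
have cs : c \in s.
  apply/negPn/negP=> cs.
  suff PN : P (c |: W1, [set w; c] |: F1).
    by have := max1 _ PN; rewrite /= cardsU1 cW1 add1n ltnn.
  apply/andP; split.
    by rewrite inE /= setU1r // andbT; apply/treesP.
  rewrite disjoint_subset; apply/subsetP=> z /setU1P[->|/sW1]; rewrite !inE //.
have [|S2 S3 _] := branching sE cs sU t0 _ (setU11 _ _) (setU1r _ yW1).
  by move=> z /setU1P[//|/sW1/negPf->].
set q := #|c |: W1| in S2 S3.
(* The trees supplied by [S3] have [q.+2] vertices inside [U], so both peaks fall within the range
   of sizes. *)
have qU : q.+2 <= #|U|.
  have /card_gt0P[p] := ltnW (ltnW S3).
  by case/setIdP=> /setIdP[/treesP[_ _ /subset_leq_card pU] _] /eqP pq; rewrite -pq.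
have cardU : #|U| = #|W|.+1 by rewrite cardsU1 yW.
have -> : #|W| + 4 = \sum_(i < #|U|) (1 + (i == q :> nat) + 2 * (i == q.+1 :> nat)).
  by rewrite sum_peaks qU (ltnW qU) cardU addn1 muln1 addn2 addn4.
apply: (@sum_size_leq _ _ _ (fun i => 1 + (i == q) + 2 * (i == q.+1))) => i iU.
case: (eqVneq i q) => [->|_]; first by rewrite ltn_eqF.
case: (eqVneq i q.+1) => [->|_] //.
exact: some_tree_of_size.
Qed.

(** Induction along connected sets starting from the cycle. A new vertex contributes m + 4 trees,
    half the increment of m(m+1) + 6(m-2). *)
Lemma card_trees_lower E (s : seq V) : is_cycle_seq E s -> connected_on setT E ->
  n * n.+1 + 6 * (n - 2) <= 2 * #|trees E setT|.
Proof.
move=> sE cE; have [us s3 _] := sE.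
have [cC tC] := card_trees_cycle sE.
have cardC : #|[set x in s]| = size s by rewrite cardsE; apply/card_uniqP.
suff: forall m, size s <= m <= n -> exists W, [/\ #|W| = m, {subset s <= W},
    connected_on W (induced E W) & m * m.+1 + 6 * (m - 2) <= 2 * #|trees E W|].
  have sn : size s <= n by rewrite -cardC -[leqRHS]card_ord max_card.
  move=> /(_ n)[|W [cW _ _]]; first by rewrite sn leqnn.
  have /eqP-> // : W == setT by rewrite eqEcard subsetT cardsT card_ord cW leqnn.
elim=> [/andP[s0]|m IHm /andP[sm mn]]; first by move: s3 s0; clear; lia.
move: sm; rewrite leq_eqVlt => /orP[/eqP Em|sm].
  exists [set x in s]; rewrite -Em; split=> //.
  by move=> x; rewrite inE.
have [|W [cardW sW cW tW]] := IHm; first by rewrite -ltnS sm ltnW.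
have [x xs] : exists x, x \in s by case: (s) s3 => // x l _; exists x; rewrite mem_head.
have /properP[_ [z _ zW]] : W \proper setT.
  by rewrite properEcard subsetT cardsT card_ord cardW.
have [a [b [aW bW /andP[_ abE]]]] :=
  connect_exit (cE _ _ (in_setT x) (in_setT z)) (sW _ xs) zW.
exists (b |: W); split.
- by rewrite cardsU1 bW cardW.
- by move=> u /sW uW; rewrite setU1r.
- exact: induced_conn_add cW aW bW abE.
rewrite card_treesU1 //.
have := card_trees_off_cycle sE sW cW aW bW abE.
move: tW s3 sm; rewrite cardW; clear; nia.
Qed.
End LowerBound.

(** * Subtrees of UP *)

Section Leaf.
Variable n : nat.
Notation V := 'I_n.
Notation graph := {set {set V}}.
Implicit Types (E F H Z : graph) (U W : {set V}) (p : {set V} * graph).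

Lemma connect_map (e e' : rel V) (f : V -> V) :
  (forall a b, e a b -> connect e' (f a) (f b)) ->
  forall a b, connect e a b -> connect e' (f a) (f b).
Proof.
move=> ef a b /connectP[p]; elim: p a => [|c p IHp] a /=; first by move=> _ ->.
by case/andP=> /ef ac /IHp cb bl; apply: connect_trans ac (cb bl).
Qed.

Lemma simple_edge_mem E e y : simple_graph E -> e \in E -> y \in e ->
  exists z, e = [set y; z].
Proof.
move=> sE /sE/eqP/cards2P[a [b [_ ->]]] /set2P[]->; first by exists b.
by exists a; rewrite setUC.
Qed.

Lemma tree_in_edge E U W F x y : tree_in E U (W, F) -> [set x; y] \in F ->
  (x \in W) && (y \in W).
Proof. by case=> [[_ eW] _ _] /eW; rewrite subUset !sub1set. Qed.

(** Since [W] has a further vertex, connectivity gives [y] an edge, which can only lead to [x]. *)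
Lemma tree_remove_leaf E U W F x y : simple_graph E -> tree_in E U (W, F) ->
  y \in W -> W != [set y] -> (forall z, [set y; z] \in F -> z = x) ->
  [/\ x \in W, [set x; y] \in F & tree_in E (U :\ y) (W :\ y, F :\ [set x; y])].
Proof.
move=> sE tW yW nWy yx; have [[/= sF eW] [_ [cW aF]] /= sWU] := tW.
have /subsetPn[w wW wy] : ~~ (W \subset [set y]).
  by apply: contra nWy => Wy; rewrite eqEsubset Wy sub1set.
have [a [b [/set1P-> nb /andP[nyb ybF]]]] := connect_exit (cW _ _ yW wW) (set11 y) wy.
have bx := yx _ ybF; rewrite {b}bx setUC in nb nyb ybF.
have /andP[xW _] := tree_in_edge tW ybF.
have nxy : x != y by rewrite eq_sym.
split=> //; split=> /=; last by apply: setSD.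
- split; first by apply: subset_trans (subsetDl _ _) sF.
  move=> e /setD1P[nexy eF]; rewrite subsetD1 eW //=.
  apply/negP=> ye; have [z ez] := simple_edge_mem sE (subsetP sF _ eF) ye.
  by move: nexy eF; rewrite ez => + /yx zx; rewrite zx setUC eqxx.
- split; first by apply/set0Pn; exists x; rewrite !inE nxy.
  split; last by apply: acyclicS aF; apply: subsetDl.
  (* Contracting the leaf onto its neighbour preserves connections. *)
  pose f z := if z == y then x else z.
  have fE z : z != y -> f z = z by rewrite /f => /negPf->.
  move=> u v /setD1P[uy uW] /setD1P[vy vW].
  rewrite -(fE u uy) -(fE v vy); move: (cW _ _ uW vW); apply: connect_map.
  move=> a' b' /andP[nab abF]; rewrite /f.
  case: (eqVneq a' y) abF nab => [->|ay] abF nab.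
    by rewrite (yx _ abF); case: ifP.
  case: (eqVneq b' y) abF => [->|bY] abF.
    by rewrite setUC in abF; rewrite (yx _ abF).
  apply: connect1; rewrite /adj nab !inE abF andbT.
  apply/eqP=> /setP/(_ y); rewrite !inE eqxx orbT !(eq_sym y).
  by rewrite (negPf ay) (negPf bY).
Qed.

(** Every vertex other than [v] is connected to [v] and so lies on an edge. Trees through a fixed
    vertex are thus determined by their edges. *)
Lemma tree_vertices E U W F v : tree_in E U (W, F) -> v \in W -> W = v |: cover F.
Proof.
move=> [[/= sF eW] [_ [cW aF]] _] vW; apply/setP=> x; apply/idP/setU1P.
  move=> xW; have [->|nxv] := eqVneq x v; [by left | right].
  have [|a [b [/set1P-> _ /andP[_ xbF]]]] := connect_exit (cW _ _ xW vW) (set11 x).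
    by rewrite inE eq_sym.
  by apply/bigcupP; exists [set x; b] => //; rewrite !inE eqxx.
by case=> [->//|/bigcupP[e /eW/subsetP]]; apply.
Qed.

Lemma edges_inj E U v : {in trees_through E U v &, injective snd}.
Proof.
move=> [W F] [W' F'] /setIdP[/treesP tW /= vW] /setIdP[/treesP tW' /= vW'] FF'.
by rewrite (tree_vertices tW vW) (tree_vertices tW' vW') -FF'.
Qed.

Lemma through_edges E U v (A : {set graph}) :
  (forall p, p \in trees_through E U v -> p.2 \in A) -> #|trees_through E U v| <= #|A|.
Proof.
move=> pA; rewrite -(card_in_imset (@edges_inj E U v)).
by apply/subset_leq_card/subsetP=> _ /imsetP[p /pA pA' ->].
Qed.

Lemma trees_through_pow E U v : #|trees_through E U v| <= 2 ^ #|induced E U|.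
Proof.
rewrite -card_powerset; apply: through_edges => p /setIdP[/treesP].
by case/tree_in_induced=> [[sF _] _ _] _; rewrite inE.
Qed.

Lemma mk_graphP (r : nat -> nat -> bool) (e : {set V}) :
  reflect (exists x y : V, [/\ x < y, r x y & e = [set x; y]]) (e \in mk_graph n r).
Proof.
rewrite inE; apply: (iffP existsP) => [[x /existsP[y /and3P[xy rxy /eqP->]]]|].
  by exists x, y.
case=> x [y [xy rxy ->]]; exists x; apply/existsP; exists y.
by rewrite xy rxy eqxx.
Qed.

Lemma mk_graph_simple r : simple_graph (mk_graph n r).
Proof.
move=> e /mk_graphP[x [y [xy _ ->]]]; rewrite cards2.
by rewrite -val_eqE /= (ltn_eqF xy).
Qed.

Lemma mk_graph_edge r (x y : V) : x < y -> ([set x; y] \in mk_graph n r) = r x y.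
Proof.
move=> xy; apply/mk_graphP/idP => [[a [b [ab rab /setP ee]]]|rxy]; last by exists x, y.
have := ee x; have := ee y; rewrite !inE !eqxx orbT.
move=> /esym/orP[]/eqP yE /esym/orP[]/eqP xE; subst; move: ab xy; rewrite ?ltnn //.
by move=> xy yx; have := ltn_trans xy yx; rewrite ltnn.
Qed.

End Leaf.

(** * Counting the trees of [UP] along its vertex order *)

Section UPcount.
Variable n : nat.
Hypothesis n3 : 3 <= n.
Notation V := 'I_n.
Notation UP := (UP n).
Definition below k : {set V} := [set i : V | i < k].

Lemma belowS k (hk : k < n) : below k.+1 = Ordinal hk |: below k.
Proof. by apply/setP=> i; rewrite !inE -val_eqE /= ltnS leq_eqVlt. Qed.

(** The vertex [v] is the end of the tail. Removing it with its edge sends the trees through [v],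
    apart from [v] alone, injectively to trees through [u]. *)
Lemma UP_through_step (v u : V) : u.+1 = v -> 3 <= v ->
  #|trees_through UP (below v.+1) v| <= #|trees_through UP (below u.+1) u|.+1.
Proof.
move=> uv v3; set A := trees_through _ _ v.
pose f (p : {set V} * {set {set V}}) := (p.1 :\ v, p.2 :\ [set u; v]).
pose p0 : {set V} * {set {set V}} := ([set v], set0).
have main p : p \in A :\ p0 ->
    [/\ v \in p.1, [set u; v] \in p.2 & f p \in trees_through UP (below u.+1) u].
  case: p => W F /setD1P[np0 /setIdP[/treesP tW /= vW]].
  have [[/= sF eW] _ /= sWU] := tW.
  (* A neighbour of [v] inside [below v.+1] is smaller than [v], and [3 <= v] rules out the triangle
     edges. *)
  have vu z : [set v; z] \in F -> z = u.
    move=> vzF; have /andP[_ /(subsetP sWU)] := tree_in_edge tW vzF.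
    have := edge_neq (@mk_graph_simple _ _) (subsetP sF _ vzF).
    rewrite inE ltnS -val_eqE /= => nvz zv; have zv' : z < v by lia.
    have := subsetP sF _ vzF; rewrite setUC mk_graph_edge // => r.
    by apply: val_inj => /=; lia.
  have nW : W != [set v].
    apply: contraNneq np0 => Wv; rewrite -pair_eqE /= Wv eqxx /=.
    apply/eqP/setP=> e; rewrite inE; apply/negP=> eF.
    have := subset_leq_card (eW e eF).
    by rewrite Wv cards1 (mk_graph_simple (subsetP sF _ eF)).
  have [uW uvF tN] := tree_remove_leaf (@mk_graph_simple _ _) tW vW nW vu.
  split=> //; rewrite inE /= !inE uW -val_eqE /= -uv (ltn_eqF (leqnn _)) !andbT.
  apply/asboolP; apply: tree_in_S tN => //.
  by apply/subsetP=> z; rewrite !inE -val_eqE /=; lia.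
have f_inj : {in A :\ p0 &, injective f}.
  move=> [W F] [W' F'] /main[/= vW vF _] /main[/= vW' vF' _] [eW eF].
  by rewrite -(setD1K vW) -(setD1K vF) eW eF setD1K // setD1K.
rewrite (cardsD1 p0 A) -add1n leq_add ?leq_b1 // -(card_in_imset f_inj).
by apply/subset_leq_card/subsetP=> _ /imsetP[p /main[_ _ fp] ->].
Qed.

Let v0 : V := Ordinal (ltn_trans (isT : 0 < 2) n3).
Let v1 : V := Ordinal (ltn_trans (isT : 1 < 2) n3).
Let v2 : V := Ordinal n3.

Lemma UP_through0 : #|trees_through UP (below 1) v0| <= 1.
Proof.
apply: leq_trans (trees_through_pow _ _ _) _.
rewrite (_ : induced _ _ = set0) ?cards0 //.
apply/setP=> e; rewrite in_set0; apply/negP=> /setIdP[eUP sub].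
have := mk_graph_simple eUP; have := subset_leq_card sub.
rewrite (_ : below 1 = [set v0]) ?cards1; first by lia.
by apply/setP=> i; rewrite !inE -val_eqE /=; lia.
Qed.

Lemma UP_through1 : #|trees_through UP (below 2) v1| <= 2.
Proof.
apply: leq_trans (trees_through_pow _ _ _) _.
suff : induced UP (below 2) \subset [set [set v0; v1]].
  by move/subset_leq_card; rewrite cards1; case: #|_| => [|[]].
apply/subsetP=> e /setIdP[/mk_graphP[x [y [xy _ ->]]]].
rewrite subUset !sub1set !inE => /andP[x2 y2].
have -> : x = v0 by apply: val_inj => /=; lia.
have -> // : y = v1 by apply: val_inj => /=; lia.
Qed.

(** Of the eight sets of triangle edges two are excluded: all three edges form a cycle, and [e01]
    alone does not reach [v2]. *)
Lemma UP_through2 : #|trees_through UP (below 3) v2| <= 6.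
Proof.
pose e01 := [set v0; v1]; pose e02 := [set v0; v2]; pose e12 := [set v1; v2].
pose T := [set e01; e02; e12].
have sT : induced UP (below 3) \subset T.
  apply/subsetP=> e /setIdP[/mk_graphP[x [y [xy _ ->]]]].
  rewrite subUset !sub1set !in_set => /andP[x2 y2].
  have [x0|x0] : x = v0 \/ x = v1.
  - have [h|h] : x = 0 :> nat \/ x = 1 :> nat by lia.
      by left; apply: val_inj.
    by right; apply: val_inj.
  - have [->|->] : y = v1 \/ y = v2.
      have [h|h] : y = 1 :> nat \/ y = 2 :> nat by move: xy; rewrite x0 /=; lia.
        by left; apply: val_inj.
      by right; apply: val_inj.
    + by rewrite x0 /T !inE eqxx.
    + by rewrite x0 /T !inE eqxx orbT.
  - have -> : y = v2 by apply: val_inj => /=; move: x0 => /(congr1 val) /=; lia.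
    by rewrite x0 /T !inE eqxx !orbT.
have e01_02 : e01 != e02.
  by apply/eqP=> /setP/(_ v1); rewrite !inE -!val_eqE.
have cardT : #|powerset T| <= 8.
  rewrite card_powerset (leq_exp2l _ 3) //.
  by rewrite (leq_trans (leq_card_setU _ _)) // cards1 cards2 addn1 ltnS; case: (_ != _).
suff : #|trees_through UP (below 3) v2| <= #|(powerset T :\ T) :\ [set e01]|.
  move: cardT; rewrite (cardsD1 T) (cardsD1 [set e01]).
  rewrite inE subxx !inE sub1set !inE eqxx /= andbT.
  suff -> : [set e01] != T by lia.
  by apply/eqP=> /setP/(_ e02); rewrite !inE eqxx orbT eq_sym (negPf e01_02).
apply: through_edges => -[W F] /setIdP[/treesP tW /= vW].
have /tree_in_induced[[/= sF eW] [_ [cW aF]] _] := tW.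
rewrite !inE (subset_trans sF sT) andbT; apply/andP; split.
  apply/eqP=> F1.
  have /andP[W0 _] : (v0 \in W) && (v1 \in W).
    by apply: tree_in_edge tW _; rewrite F1 inE.
  have [|a [b [/set1P-> _]]] := connect_exit (cW _ _ vW W0) (set11 _).
    by rewrite inE -val_eqE.
  rewrite /adj F1 inE => /andP[_ /eqP/setP/(_ v2)].
  by rewrite !inE -!val_eqE.
apply/eqP=> FT; apply: (aF [:: v0; v1; v2]); split=> //.
have t01 : [set v0; v1] \in T by rewrite /T !inE eqxx.
have t12 : [set v1; v2] \in T by rewrite /T !inE eqxx !orbT.
have t20 : [set v2; v0] \in T by rewrite setUC /T !inE eqxx !orbT.
by rewrite /= FT /adj t01 t12 t20 -!val_eqE.
Qed.

Lemma UP_through_le (v : V) : 2 <= v -> #|trees_through UP (below v.+1) v| <= v + 4.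
Proof.
case: v => v hv /=; elim: v hv => // v IHv hv; rewrite leq_eqVlt => /orP[/eqP Ev|v2'].
  case: v Ev hv IHv => [|[]] // _ hv _.
  by rewrite (_ : Ordinal hv = v2); [exact: UP_through2 | apply: val_inj].
have hv' := ltnW hv.
have := @UP_through_step (Ordinal hv) (Ordinal hv') erefl v2'.
by have := IHv hv' v2'; rewrite /=; lia.
Qed.

Lemma card_trees_UP : 2 * #|trees UP setT| <= n * n.+1 + 6 * (n - 2).
Proof.
have trees0 : #|trees UP (below 0)| = 0.
  apply/eqP; rewrite cards_eq0; apply/eqP/setP=> p; rewrite in_set0.
  apply/negP=> /treesP[_ [/set0Pn[x xp] _]] /subsetP/(_ _ xp).
  by rewrite inE.
have step k (hk : k < n) : #|trees UP (below k.+1)| =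
    #|trees UP (below k)| + #|trees_through UP (below k.+1) (Ordinal hk)|.
  by rewrite belowS card_treesU1 // inE ltnn.
(* The three triangle vertices contribute at most 1 + 2 + 6. Afterwards vertex k adds at most k + 4,
   the increment of the lower bound. *)
have t3 : #|trees UP (below 3)| <= 9.
  rewrite (step 2 n3) (step 1 (ltn_trans (isT : 1 < 2) n3)).
  rewrite (step 0 (ltn_trans (isT : 0 < 2) n3)) trees0.
  by rewrite (leq_add (leq_add UP_through0 UP_through1) UP_through2).
suff: forall k, 3 <= k <= n -> 2 * #|trees UP (below k)| <= k * k.+1 + 6 * (k - 2).
  move=> /(_ n); rewrite n3 leqnn => /(_ isT).
  rewrite (_ : below n = setT) //; by apply/setP=> i; rewrite !inE ltn_ord.
elim=> // k IHk /andP[]; rewrite leq_eqVlt => /orP[/eqP[<-] _|k3 kn].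
  by move: t3; lia.
have := IHk; rewrite (ltnW kn) andbT => /(_ k3).
rewrite (step _ kn).
have := @UP_through_le (Ordinal kn) (ltnW k3); rewrite /=.
by move: k3; move: #|_| #|_|; clear; nia.
Qed.

End UPcount.

(** * The upper bound *)

Section Upper.
Variable n : nat.
Notation V := 'I_n.
Notation graph := {set {set V}}.
Implicit Types (E F H Z : graph) (U W : {set V}) (p : {set V} * graph).

(** A tree with at least one edge is encoded by its edge set, [cover] recovering the vertices;
    counting then takes place among the subsets of [E]. *)
Definition edge_tree F := (F != set0) && `[< is_tree (cover F) F >].

Definition edge_trees E : {set graph} := [set F in powerset E | edge_tree F].

Lemma coverP F x : reflect (exists2 e, e \in F & x \in e) (x \in cover F).
Proof. exact: bigcupP. Qed.

Lemma tree_in_cover E U W F : simple_graph E -> tree_in E U (W, F) -> F != set0 ->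
  W = cover F.
Proof.
move=> sE tW /set0Pn[e eF]; have [[/= sF eW] _ _] := tW.
have /set0Pn[v ve] : e != set0 by rewrite -card_gt0 (sE _ (subsetP sF _ eF)).
rewrite (tree_vertices tW (subsetP (eW _ eF) _ ve)).
by apply/setUidPr; rewrite sub1set; apply/coverP; exists e.
Qed.

Lemma tree_in_edge_tree E U W F : simple_graph E -> tree_in E U (W, F) ->
  F != set0 -> F \in edge_trees E.
Proof.
move=> sE tW nF; have [[/= sF eW] tF _] := tW.
rewrite inE inE sF /edge_tree nF -(tree_in_cover sE tW nF) /=.
exact/asboolP.
Qed.

(** The trees without edges are the [n] single vertices; all others are determined by their edge
    sets. *)
Lemma card_trees_edge_trees E : simple_graph E -> #|trees E setT| = n + #|edge_trees E|.
Proof.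
move=> sE.
rewrite -(cardsID [set p : {set V} * graph | p.2 == set0] (trees E setT)); congr (_ + _).
  pose f (v : V) : {set V} * graph := ([set v], set0).
  have f_inj : injective f by move=> x y [/set1_inj].
  rewrite -[RHS]card_ord -(card_imset _ f_inj); apply: eq_card => -[W F].
  apply/setIP/imsetP => [[/treesP tW]|[v _ ->]]; last first.
    by rewrite inE eqxx; split=> //; apply/treesP/tree_in1.
  rewrite inE /= => /eqP F0; subst F.
  have [_ [/set0Pn[v vW] _] _] := tW; exists v => //.
  by rewrite (tree_vertices tW vW) /f /cover big_set0 setU0.
pose A := trees E setT :\: [set p : {set V} * graph | p.2 == set0].
have AP W F : (W, F) \in A -> [/\ tree_in E setT (W, F), F != set0 & W = cover F].
  case/setDP=> /treesP tW; rewrite inE /= => nF; split=> //.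
  exact: tree_in_cover tW nF.
have inj : {in A &, injective snd}.
  by move=> [W F] [W' F'] /AP[_ _ ->] /AP[_ _ ->] /= ->.
rewrite -/A -(card_in_imset inj); apply: eq_card => F.
apply/imsetP/idP => [[[W F'] /AP[tW nF _] ->]|].
  exact: tree_in_edge_tree tW nF.
rewrite inE => /andP[sF /andP[nF /asboolP tF]].
exists (cover F, F) => //; rewrite !inE /= nF /=; apply/asboolP; split=> //.
split=> /=; first by rewrite inE in sF.
by move=> e eF; apply: bigcup_sup eF.
Qed.

Lemma edge_tree_closed F x y : edge_tree F -> x \in cover F -> y \in cover F ->
  x != y -> [set x; y] \notin F -> ~~ edge_tree ([set x; y] |: F).
Proof.
case/andP=> _ /asboolP[_ [cF _]] xF yF nxy nF.
have [s [cs _ _]] := close_cycle (cF _ _ xF yF) nxy nF.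
by apply/negP=> /andP[_ /asboolP[_ [_ /(_ s)]]].
Qed.

(** Connectivity would need an edge leaving [cover Z], but edges of [Z] stay inside it and the new
    edge stays outside. *)
Lemma edge_tree_apart E Z x y : simple_graph E -> Z \subset E -> Z != set0 ->
  x \notin cover Z -> y \notin cover Z -> ~~ edge_tree ([set x; y] |: Z).
Proof.
move=> sE sZ /set0Pn[e eZ] xZ yZ; apply/negP=> /andP[_ /asboolP[_ [cF _]]].
have /set0Pn[z ze] : e != set0 by rewrite -card_gt0 (sE _ (subsetP sZ _ eZ)).
have zZ : z \in cover Z by apply/coverP; exists e.
have zF : z \in cover ([set x; y] |: Z).
  by apply/coverP; exists e => //; rewrite setU1r.
have xF : x \in cover ([set x; y] |: Z).
  by apply/coverP; exists [set x; y]; rewrite ?setU11 // !inE eqxx.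
have [a [b [aZ bZ /andP[_ /setU1P[ab|ab]]]]] := connect_exit (cF _ _ zF xF) zZ xZ.
  have : a \in [set x; y] by rewrite -ab !inE eqxx.
  by case/set2P=> ax; rewrite ax ?(negPf xZ) ?(negPf yZ) in aZ.
by case/negP: bZ; apply/coverP; exists [set a; b] => //; rewrite !inE eqxx orbT.
Qed.

Lemma cover_set2 F x y : [set x; y] \in F -> (x \in cover F) && (y \in cover F).
Proof.
by move=> xyF; apply/andP; split; apply/coverP; exists [set x; y] => //;
  rewrite !inE eqxx ?orbT.
Qed.

(** * Non-trees forced by three consecutive edges *)

Section Walk.
Variables (E Z : graph) (u v w t : V).
Hypotheses (sE : simple_graph E) (sZ : Z \subset E).
Let e := [set u; v].
Let f := [set v; w].
Let h := [set w; t].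
Hypotheses (eE : e \in E) (fE : f \in E) (hE : h \in E).
Hypotheses (ef : e != f) (fh : f != h).
Hypotheses (eZ : e \notin Z) (fZ : f \notin Z) (hZ : h \notin Z).

(** The edges [e] and [h] already cover [v] and [w], so adding [f] to a tree containing both closes
    a cycle. *)
Lemma walk_bad_both : ~~ (edge_tree (e |: (h |: Z)) && edge_tree (f |: (e |: (h |: Z)))).
Proof.
apply/negP=> /andP[g1 g2].
have /negP[] // : ~~ edge_tree (f |: (e |: (h |: Z))).
apply: edge_tree_closed g1 _ _ _ _.
- have /andP[] // := @cover_set2 (e |: (h |: Z)) u v (setU11 _ _).
- have /andP[] // := @cover_set2 (e |: (h |: Z)) w t (setU1r _ (setU11 _ _)).
- exact: edge_neq fE.
- by rewrite !inE -/f !negb_or eq_sym ef fh.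
Qed.

(** If [Z] covers both ends of [f], then [f] closes a cycle; if neither, [f] is disjoint from [Z].
    If it covers only [v], then [h] must meet [Z] in [t] and closes a cycle once [f] is added; the
    case of [w] is symmetric, with [e]. *)
Lemma walk_bad_one : ~~ [&& edge_tree Z, edge_tree (e |: Z), edge_tree (f |: Z),
  edge_tree (h |: Z), edge_tree (e |: (f |: Z)) & edge_tree (h |: (f |: Z))].
Proof.
apply/negP=> /and5P[gZ ge gf gh /andP[gef ghf]].
have nZ : Z != set0 by case/andP: gZ.
have [nuv nvw nwt] : [/\ u != v, v != w & w != t] by split; apply: edge_neq sE _.
have cf x : x \in cover Z -> x \in cover (f |: Z).
  by case/coverP=> d dZ xd; apply/coverP; exists d; rewrite ?setU1r.
have /andP[vf wf] := @cover_set2 (f |: Z) v w (setU11 _ _).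
have touch x y : edge_tree ([set x; y] |: Z) -> x \in cover Z \/ y \in cover Z.
  move=> g; have [xZ|xZ] := boolP (x \in cover Z); first by left.
  have [yZ|yZ] := boolP (y \in cover Z); first by right.
  by case/negP: (edge_tree_apart sE sZ nZ xZ yZ).
have [vZ|vZ] := boolP (v \in cover Z); have [wZ|wZ] := boolP (w \in cover Z).
- by case/negP: (edge_tree_closed gZ vZ wZ nvw fZ).
- have [wZ'|tZ] := touch _ _ gh; first by rewrite wZ' in wZ.
  have hf : h \notin f |: Z by rewrite !inE negb_or eq_sym fh.
  by case/negP: (edge_tree_closed gf wf (cf _ tZ) nwt hf).
- have [uZ|vZ'] := touch _ _ ge; last by rewrite vZ' in vZ.
  have ef' : e \notin f |: Z by rewrite !inE negb_or ef.
  by case/negP: (edge_tree_closed gf (cf _ uZ) vf nuv ef').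
- by case: (touch _ _ gf) => H; rewrite H in vZ wZ.
Qed.

End Walk.

(** Subsets of [E] are grouped by their part outside [R], the set of the three edges. Each of the
    2^(m-3) groups, where m = #|E|, contains at least two non-trees, so at most 2^m - 2^(m-2) trees
    remain. *)
Lemma card_edge_trees_walk E u v w t : simple_graph E ->
  [set u; v] \in E -> [set v; w] \in E -> [set w; t] \in E ->
  [set u; v] != [set v; w] -> [set v; w] != [set w; t] -> [set u; v] != [set w; t] ->
  3 <= #|E| /\ #|edge_trees E| <= 3 * 2 ^ (#|E| - 2).
Proof.
set e := [set u; v]; set f := [set v; w]; set h := [set w; t].
move=> sE eE fE hE ef fh eh.
pose R := e |: (f |: [set h]).
have cR : #|R| = 3.
  by rewrite !cardsU1 cards1 !inE !negb_or ef fh eh.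
have sR : R \subset E by rewrite !subUset !sub1set eE fE hE.
have E3 : 3 <= #|E| by rewrite -cR subset_leq_card.
split=> //.
pose Bad := powerset E :\: edge_trees E.
(* Containing both [e] and [h] separates the two families of non-trees, so that none is counted
   twice. *)
pose EH := [set F : graph | (e \in F) && (h \in F)].
have EHE F : (F \in EH) = (e \in F) && (h \in F) by rewrite in_set.
have BadP F : F \subset E -> ~~ edge_tree F -> F \in Bad.
  by move=> sF bF; rewrite !inE sF (negPf bF).
have ZP (Z : graph) : Z \in powerset (E :\: R) ->
    [/\ Z \subset E, e \notin Z, f \notin Z & h \notin Z].
  rewrite inE subsetD => /andP[sZ /disjointFl dZ].
  by split=> //; rewrite dZ // !inE eqxx ?orbT.
have strip (Z Y : graph) : Z \in powerset (E :\: R) -> Y \subset R ->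
    Z = (Y :|: Z) :\: R.
  rewrite inE subsetD => /andP[_ /setDidPl dZ]; rewrite setDUl dZ -setD_eq0.
  by move/eqP->; rewrite set0U.
have sZR (Z Y : graph) : Z \in powerset (E :\: R) -> Y \subset R -> Y :|: Z \subset E.
  by move=> /ZP[sZ _ _ _] sY; rewrite subUset sZ (subset_trans sY).
have [eR fR hR] : [/\ [set e] \subset R, [set f] \subset R & [set h] \subset R].
  by rewrite !sub1set !inE !eqxx !orbT.
have efR : [set e; f] \subset R by rewrite subUset eR.
have ehR : [set e; h] \subset R by rewrite subUset eR.
have hfR : [set h; f] \subset R by rewrite subUset hR.
have fehR : f |: [set e; h] \subset R by rewrite subUset fR.
(* Removing [R] maps each family onto all subsets of [E :\: R], which bounds its size from below. *)
have cover1 : powerset (E :\: R) \subset [set F :\: R | F in Bad :&: EH].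
  apply/subsetP=> Z ZE; have [sZ eZ fZ hZ] := ZP _ ZE.
  have := walk_bad_both sE fE ef fh fZ; rewrite -/e -/f -/h negb_and.
  rewrite !setUA -/f; case/orP=> bad; apply/imsetP.
    exists ([set e; h] :|: Z); last exact: strip.
    apply/setIP; split; first exact: BadP (sZR _ _ ZE ehR) bad.
    by rewrite EHE !in_setU !in_set1 !eqxx !orbT.
  exists ((f |: [set e; h]) :|: Z); last exact: strip.
  apply/setIP; split; last by rewrite EHE !in_setU !in_set1 !eqxx !orbT.
  by apply: BadP (sZR _ _ ZE fehR) _; rewrite !setUA.
have cover2 : powerset (E :\: R) \subset [set F :\: R | F in Bad :\: EH].
  apply/subsetP=> Z ZE; have [sZ eZ fZ hZ] := ZP _ ZE.
  have fin (Y : graph) : Y \subset R -> ~~ ((e \in Y) && (h \in Y)) ->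
      ~~ edge_tree (Y :|: Z) -> Z \in [set F :\: R | F in Bad :\: EH].
    move=> sY nY bad; apply/imsetP; exists (Y :|: Z); last exact: strip.
    rewrite in_setD BadP ?sZR // andbT EHE !in_setU (negPf eZ) (negPf hZ) !orbF.
    exact: nY.
  have he : h != e by rewrite eq_sym.
  have hf : h != f by rewrite eq_sym.
  have := walk_bad_one sE sZ eE fE hE ef fh eZ fZ hZ; rewrite -/e -/f -/h.
  case/nandP=> [bad|/nandP[bad|/nandP[bad|/nandP[bad|/nandP[bad|bad]]]]].
  - by apply: (fin set0); rewrite ?sub0set ?in_set0 ?set0U.
  - by apply: (fin [set e]); rewrite // !in_set1 (negPf he) andbF.
  - by apply: (fin [set f]); rewrite // !in_set1 (negPf ef).
  - by apply: (fin [set h]); rewrite // !in_set1 (negPf eh).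
  - by apply: (fin [set e; f]); rewrite -?setUA // !in_setU !in_set1 (negPf he) (negPf hf)
       andbF.
  - by apply: (fin [set h; f]); rewrite -?setUA // !in_setU !in_set1 (negPf eh) (negPf ef).
have c1 := leq_trans (subset_leq_card cover1) (leq_imset_card _ _).
have c2 := leq_trans (subset_leq_card cover2) (leq_imset_card _ _).
rewrite card_powerset cardsDS // cR in c1 c2.
have := cardsID EH Bad; have := cardsDS (_ : edge_trees E \subset powerset E).
rewrite -/Bad card_powerset => -> //; last first.
  by apply/subsetP=> F; rewrite inE => /andP[].
have le : #|edge_trees E| <= 2 ^ #|E|.
  rewrite -card_powerset; apply/subset_leq_card/subsetP=> F.
  by rewrite inE => /andP[].
move: le c1 c2 E3.
move: #|edge_trees E| #|Bad :&: EH| #|Bad :\: EH| #|E| => T b1 b2 m; clear.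
move=> le c1 c2 m3 Eb; rewrite -(subnK m3) in le Eb *.
move: (m - 3) c1 c2 le Eb => k; rewrite !addn3 subSS subSS subn0 !expnS; lia.
Qed.

(** Four successive vertices of the cycle serve. In a triangle the fourth is the first again, and
    the three edges are still distinct. *)
Lemma unicyclic_walk E : simple_graph E -> unicyclic E -> exists u v w t,
  [/\ [set u; v] \in E, [set v; w] \in E & [set w; t] \in E] /\
  [/\ [set u; v] != [set v; w], [set v; w] != [set w; t] & [set u; v] != [set w; t]].
Proof.
move=> sE [_ [C [[s [[us s3 cs] _]] _]]].
have [x xs] : exists x, x \in s by case: (s) s3 => // x l _; exists x; rewrite mem_head.
pose v := next s x; pose w := next s v; pose t := next s w.
have [vs ws] : v \in s /\ w \in s by rewrite !mem_next.
have edge y : y \in s -> [set y; next s y] \in E.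
  by move=> ys; have /andP[] := next_cycle cs ys.
exists x, v, w, t; split; split; try exact: edge.
- rewrite set2_neq // eq_sym; [exact: next_neq us (ltnW s3) xs | exact: next2_neq].
- rewrite set2_neq // eq_sym; [exact: next_neq us (ltnW s3) vs | exact: next2_neq].
- rewrite eq_sym set2_neq //; first exact: next2_neq.
  exact: next_neq us (ltnW s3) vs.
Qed.

(** A spanning tree has [n] - 1 edges. Two further edges would close two cycles, of which only the
    first contains the first edge. *)
Lemma unicyclic_edges E : simple_graph E -> unicyclic E -> 0 < n -> #|E| <= n.
Proof.
move=> sE [cE [C [_ uC]]] n0.
have eT e : e \in E -> e \subset setT by rewrite subsetT.
have := @grow n E setT [set Ordinal n0] set0 n eT cE (tree_in1 _ (in_setT _)).
rewrite cards1 cards0 cardsT card_ord n0 leqnn => /(_ isT)[W [F [tW _ _ cW cF]]].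
have WT : W = setT by apply/eqP; rewrite eqEcard subsetT cardsT card_ord cW leqnn.
have [[/= sF _] [_ [conF _]] _] := tW.
rewrite -(cardsID F E) (setIidPr sF).
suff : #|E :\: F| <= 1 by move: cF; clear; lia.
rewrite leqNgt; apply/negP=> /card_gt1P[g1 [g2 [/setDP[g1E g1F] /setDP[g2E g2F] ng]]].
have cyc g : g \in E -> g \notin F -> exists2 C', is_cycle_of E C' &
    (g \in C') && (C' \subset g |: F).
  move=> gE gF; have /eqP/cards2P[x [y [nxy gxy]]] := sE _ gE; subst g.
  have [|s [[us s3 cs] gs sC]] := @close_cycle _ F x y _ nxy gF.
    by apply: conF; rewrite WT inE.
  exists (cycle_edges s); last by rewrite gs.
  exists s; split=> //; split=> //; apply: sub_cycle cs; apply: adjS.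
  by rewrite subUset sub1set gE.
(* Uniqueness makes both cycles equal to [C], which forces [g1] into [g2 |: F]. *)
have [C1 /uC <- /andP[g1C _]] := cyc _ g1E g1F.
have [C2 /uC <- /andP[_ /subsetP/(_ _ g1C)]] := cyc _ g2E g2F.
by rewrite !inE (negPf g1F) (negPf ng).
Qed.

Lemma unicyclic_edge_trees E : simple_graph E -> unicyclic E ->
  #|edge_trees E| <= 3 * 2 ^ (n - 2).
Proof.
move=> sE uE; have [u [v [w [t [[eE fE hE] [ef fh eh]]]]]] := unicyclic_walk sE uE.
have [_ le] := card_edge_trees_walk sE eE fE hE ef fh eh.
apply: leq_trans le _; rewrite leq_mul2l leq_exp2l //= leq_sub2r //.
by apply: unicyclic_edges => //; apply: leq_trans (ltn_ord u).
Qed.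

End Upper.

(** * Subtrees of US *)

Section USCount.
Variable n : nat.
Hypothesis n3 : 3 <= n.
Notation V := 'I_n.
Notation US := (US n).
Notation graph := {set {set V}}.

Let v0 : V := Ordinal (ltn_trans (isT : 0 < 2) n3).
Let v1 : V := Ordinal (ltn_trans (isT : 1 < 2) n3).
Let v2 : V := Ordinal n3.

Definition star (A : {set V}) : graph := [set [set v0; i] | i in A].
(** A left inverse of [star], insensitive to the extra edge [t]; it yields the injectivity of both
    families of trees below. *)
Definition leaves (F : graph) : {set V} := [set i | (i != v0) && ([set v0; i] \in F)].
Let t : {set V} := [set v1; v2].

Lemma US_star_edge (i : V) : i != v0 -> [set v0; i] \in US.
Proof.
rewrite -val_eqE /= => i0; have i1 : v0 < i by rewrite /= lt0n.
by rewrite mk_graph_edge //= lt0n i0.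
Qed.

Lemma US_t : t \in US.
Proof. by rewrite mk_graph_edge. Qed.

Lemma star_tree (A : {set V}) : v0 \notin A -> tree_in US setT (v0 |: A, star A).
Proof.
have [m] := ubnP #|A|; elim: m A => // m IHm A Am v0A.
have [->|/set0Pn[x xA]] := eqVneq A set0.
  by rewrite setU0 /star imset0; apply: tree_in1.
have nx0 : x != v0 by apply: contraNneq v0A => <-.
rewrite -(setD1K xA) /star imsetU1 setUCA; apply: tree_in_add => //.
- apply: IHm; first by move: Am; rewrite (cardsD1 x) xA.
  by rewrite !inE negb_and v0A orbT.
- by rewrite setU11.
- by rewrite !inE eqxx orbF.
- exact: US_star_edge.
Qed.

Lemma star_mem (A : {set V}) i : v0 \notin A -> i != v0 ->
  ([set v0; i] \in star A) = (i \in A).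
Proof.
move=> v0A i0; apply/imsetP/idP => [[j jA /setP/(_ i)]|iA]; last by exists i.
by rewrite !inE eqxx orbT (negPf i0) => /esym/eqP->.
Qed.

Lemma leaves_star (A : {set V}) : v0 \notin A -> leaves (star A) = A.
Proof.
move=> v0A; apply/setP=> i; rewrite inE.
have [->|i0] := eqVneq i v0; first by rewrite (negPf v0A).
by rewrite star_mem.
Qed.

Lemma star_t (i : V) : ([set v0; i] == t) = false.
Proof. by rewrite set2_neq // -val_eqE. Qed.

Lemma leaves_t (F : graph) : leaves (t |: F) = leaves F.
Proof. by apply/setP=> i; rewrite !inE star_t. Qed.

Lemma t_notin_star (A : {set V}) : t \notin star A.
Proof. by apply/imsetP=> -[i _ /eqP]; rewrite eq_sym star_t. Qed.

(* Adding t to a star gives a tree exactly when the star uses one of v1, v2. *)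
Let keep_one (B : {set V}) := if v2 \in B then B else v1 |: B.

(** Exactly one of [v1], [v2] lies in [keep_one B], so [t] attaches the other one as a new leaf. *)
Lemma twisted_star_tree (B : {set V}) : v0 \notin B -> v1 \notin B ->
  t |: star (keep_one B) \in edge_trees US.
Proof.
move=> v0B v1B.
have sUS : simple_graph US := @mk_graph_simple _ _.
have v0kB : v0 \notin keep_one B.
  by rewrite /keep_one; case: ifP => // _; rewrite !inE negb_or v0B -val_eqE.
have nt : t |: star (keep_one B) != set0 by apply/set0Pn; exists t; rewrite setU11.
have T := star_tree v0kB.
suff [x [y [xyt xW yW]]] : exists x y,
    [/\ [set x; y] = t, x \in v0 |: keep_one B & y \notin v0 |: keep_one B].
  rewrite -xyt in nt *; apply: tree_in_edge_tree nt => //.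
  by apply: tree_in_add T xW yW (in_setT _) _; rewrite xyt US_t.
rewrite /keep_one; have [v2B|v2B] := boolP (v2 \in B).
  exists v2, v1; rewrite setUC setU1r // !inE negb_or v1B -val_eqE; split=> //.
exists v1, v2; rewrite !inE eqxx orbT !negb_or v2B -!val_eqE; split=> //.
Qed.

(** Without [t] there are the 2^(n-1) - 1 nonempty stars. With [t] there are 2^(n-2) twisted stars
    and [t] alone. *)
Lemma card_edge_trees_US : 3 * 2 ^ (n - 2) <= #|edge_trees US|.
Proof.
have sUS : simple_graph US := @mk_graph_simple _ _.
pose T := [set F : graph | t \in F].
pose P := powerset [set~ v0]; pose Q := powerset ([set~ v0] :\ v1).
have PP A : A \in P -> v0 \notin A.
  by rewrite inE => /subsetP sA; apply/negP=> /sA; rewrite !inE eqxx.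
have QP A : A \in Q -> v0 \notin A /\ v1 \notin A.
  by rewrite inE => /subsetP sA; split; apply/negP=> /sA; rewrite !inE eqxx ?andbF.
have cV : #|[set~ v0]| = n.-1 by rewrite cardsC1 card_ord.
have cP : #|P :\ set0| = (2 ^ n.-1).-1.
  have := cardsD1 set0 P; rewrite card_powerset cV inE sub0set => ->.
  by [].
have cQ : #|Q| = 2 ^ (n - 2).
  rewrite card_powerset; congr (2 ^ _).
  have := cardsD1 v1 [set~ v0]; rewrite cV !inE -val_eqE /=; lia.
have injP : {in P :\ set0 &, injective star}.
  move=> A A' /setD1P[_ /PP a] /setD1P[_ /PP a'] eq_s.
  by rewrite -(leaves_star a) -(leaves_star a') eq_s.
have injQ : {in Q &, injective (fun B => t |: star (keep_one B))}.
  (* Dropping [v1] from the leaves undoes [keep_one], as [v1] never belongs to [B]. *)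
  suff : forall B, B \in Q -> leaves (t |: star (keep_one B)) :\ v1 = B.
    by move=> h B C BQ CQ eq_s; rewrite -(h B) // eq_s h.
  move=> B /QP[b0 b1]; rewrite leaves_t leaves_star /keep_one.
    case: ifP => _; apply/setP=> i; rewrite !inE;
    by have [->|] := eqVneq i v1; rewrite ?(negPf b1).
  by case: ifP => // _; rewrite !inE negb_or b0 -val_eqE.
rewrite -(cardsID T (edge_trees US)) addnC.
have c1 : #|P :\ set0| <= #|edge_trees US :\: T|.
  rewrite -(card_in_imset injP); apply/subset_leq_card/subsetP=> _ /imsetP[A + ->].
  case/setD1P=> nA /PP a; rewrite inE [_ \in T]inE t_notin_star /=.
  apply: tree_in_edge_tree (star_tree a) _ => //.
  by have /set0Pn[i iA] := nA; apply/set0Pn; exists [set v0; i]; apply: imset_f.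
have tt : [set t] \in edge_trees US.
  have := @tree_in_add _ US setT [set v1] set0 v1 v2 (tree_in1 _ (in_setT _)).
  rewrite -/t setU0 => /(_ (set11 _) _ (in_setT _) US_t) tr.
  apply: tree_in_edge_tree (tr _) _ => //; first by rewrite inE -val_eqE.
  by apply/set0Pn; exists t; rewrite inE.
have c2 : #|Q|.+1 <= #|edge_trees US :&: T|.
  rewrite (cardsD1 [set t]) in_setI tt inE set11 add1n ltnS.
  rewrite -(card_in_imset injQ); apply/subset_leq_card/subsetP=> _ /imsetP[B BQ ->].
  have [b0 b1] := QP _ BQ.
  rewrite in_setD1 in_setI twisted_star_tree // [_ \in T]inE setU11 !andbT.
  (* A twisted star has at least one edge at [v0], so it differs from [t] alone. *)
  apply/eqP=> /setP e.
  have b0' : v0 \notin keep_one B.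
    by rewrite /keep_one; case: ifP => // _; rewrite !inE negb_or b0 -val_eqE.
  have [i iB] : exists i, i \in keep_one B.
    by rewrite /keep_one; case: ifP => [|_]; [exists v2 | exists v1; rewrite setU11].
  have := e [set v0; i]; rewrite !inE star_t star_mem ?iB //.
  by apply: contraNneq b0' => <-.
rewrite cP in c1; rewrite cQ in c2.
apply: leq_trans (leq_add c1 c2).
have -> : n.-1 = (n - 2).+1 by lia.
by rewrite expnS; have := expn_gt0 2 (n - 2); lia.
Qed.

End USCount.

Theorem theorem1 (n : nat) (hn : 3 <= n) (G : {set {set 'I_n}}) :
  simple_graph G -> unicyclic G ->
  nsub (US n) >= nsub G /\ nsub G >= nsub (UP n).
Proof.
move=> sG uG; rewrite !nsub_trees !ltnS; split.
  rewrite !card_trees_edge_trees //; last exact: mk_graph_simple.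
  rewrite leq_add2l; apply: leq_trans (card_edge_trees_US hn).
  exact: unicyclic_edge_trees.
have [cG [C [[s [cs _]] _]]] := uG.
have := leq_trans (card_trees_UP hn) (card_trees_lower cs cG).
by rewrite leq_pmul2l.
Qed.
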